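(* Let $A$ be an affine cellular $k$-algebra with cell chain $0=J_0\subset J_1\subset\cdots\subset J_n=A$ and cell data $(B_i,\sigma_i,\Delta_i,\psi^{(i)},\alpha_i)$, $1\le i\le n$. Then: (1) If, for all $i$, $J_i/J_{i-1}$ is idempotent (as an ideal of $A/J_{i-1}$) and $\det(\psi^{(i)})$ is not a zero-divisor in $B_i$, then $\mathrm{Hom}_A(\Delta_i,\Delta_j)=0$ for any $i\ne j$. (2) For all $i$, every non-zero $A$-endomorphism of $\Delta_i$ is injective, provided $J_i/J_{i-1}$ is idempotent and $B_i$ is an integral domain.
   Context: Conventions. $k$ is a commutative Noetherian domain. A $k$-involution is a $k$-linear anti-automorphism whose square is the identity. An affine commutative $k$-algebra is a finitely generated commutative unital $k$-algebra. The element $0$ counts as a zero-divisor. An ideal $J$ is idempotent if $J^2=J$. Affine cell ideal. Let $A$ be a unital $k$-algebra with a $k$-involution $i$. A two-sided ideal $J$ with $i(J)=J$ is an affine cell ideal if (1) there are a free $k$-module $V$ of finite rank $d\ge1$ and a nonzero affine commutative $k$-algebra $B$ with $k$-involution $\sigma$ such that $\Delta:=V\otimes_kB$ is an $A$-$B$-bimodule whose right $B$-structure is induced by the regular module $B_B$; (2) there is an $A$-$A$-bimodule isomorphism $\alpha:J\to\Delta\otimes_B\Delta'$, where $\Delta'=B\otimes_kV$ is a $B$-$A$-bimodule with left $B$-structure induced by ${}_BB$ and right $A$-structure $(b\otimes v)a:=\tau(i(a)(v\otimes b))$, $\tau$ the flip, such that, identifying $\Delta\otimes_B\Delta'$ with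 $V\otimes_kB\otimes_kV$, $\alpha(i(\alpha^{-1}(u\otimes b\otimes v)))=v\otimes\sigma(b)\otimes u$. $\Delta$ is the cell module of $J$. There is a $k$-bilinear $\psi:V\times V\to B$ with $\alpha(\alpha^{-1}(u\otimes b\otimes v)\,\alpha^{-1}(u'\otimes b'\otimes v'))=u\otimes b\psi(v,u')b'\otimes v'$. Fix a basis $v_1,\dots,v_d$ of $V$; the swich matrix is $\psi=(\psi(v_r,v_s))_{r,s}\in M_d(B)$. Identifying $v_r\otimes b\otimes v_s$ with $bE_{rs}$, $\alpha$ becomes a bijection $J\to M_d(B)$ with $\alpha(xy)=\alpha(x)\psi\alpha(y)$. $(B,\sigma,\Delta,\psi,\alpha)$ is the cell datum of $J$. Affine cellular algebra. $A$ (with $i$) is affine cellular if $A=J_1'\oplus\cdots\oplus J_n'$ as $k$-modules with $i(J_j')=J_j'$, such that the $J_j=\bigoplus_{l\le j}J_l'$ form a chain of two-sided ideals $0=J_0\subset J_1\subset\cdots\subset J_n=A$ (cell chain) and each $J_j/J_{j-1}$ is an affine cell ideal of $A/J_{j-1}$ (for the induced involution), with cell datum $(B_j,\sigma_j,\Delta_j,\psi^{(j)},\alpha_j)$. The cell modules $\Delta_j$ are viewed as left $A$-modules. *)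

(* Defs.v *)
From HB Require Import structures.
From mathcomp Require Import all_boot all_order all_algebra.
From mathcomp Require Import generic_quotient ring_quotient boolp.

Set Implicit Arguments.
Unset Strict Implicit.
Unset Printing Implicit Defensive.

Import GRing.Theory.
Local Open Scope ring_scope.
Local Open Scope quotient_scope.

(* Presentation of M (x)_R N by finite formal sums of pairs (m, n). The right
   action of R on M and its left action on N are plain functions, so that the
   same construction serves for V (x)_k B and for Delta (x)_B Delta', whose
   factors carry several module structures. *)
Section Tensor.
Variables (R : Type) (M N : zmodType) (ra : M -> R -> M) (la : R -> N -> N).

Inductive tens_rel : seq (M * N) -> seq (M * N) -> Prop :=
| tr_refl s : tens_rel s s
| tr_sym s t : tens_rel s t -> tens_rel t s
| tr_trans s t u : tens_rel s t -> tens_rel t u -> tens_rel s u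
| tr_cat s s' t t' :
    tens_rel s s' -> tens_rel t t' -> tens_rel (s ++ t) (s' ++ t')
| tr_catC s t : tens_rel (s ++ t) (t ++ s)
| tr_zero n : tens_rel [:: (0, n)] [::]
| tr_addl m m' n : tens_rel [:: (m + m', n)] [:: (m, n); (m', n)]
| tr_addr m n n' : tens_rel [:: (m, n + n')] [:: (m, n); (m, n')]
| tr_bal m r n : tens_rel [:: (ra m r, n)] [:: (m, la r n)].

Definition tens_relb s t := `[< tens_rel s t >].

Lemma tens_relb_equiv : equiv_class_of tens_relb.
Proof.
split=> [s|s t|t s u].
- exact/asboolP/tr_refl.
- by apply/asboolP/asboolP; exact: tr_sym.
- by move=> /asboolP st /asboolP tu; apply/asboolP; exact: tr_trans st tu.
Qed.

Canonical tens_relb_equiv_rel := EquivRelPack tens_relb_equiv.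

Definition tensor := {eq_quot tens_relb}.

HB.instance Definition _ := Choice.on tensor.
HB.instance Definition _ : EqQuotient (seq (M * N)) tens_relb tensor :=
  EqQuotient.on tensor.

Definition tclass (s : seq (M * N)) : tensor := \pi s.

Lemma tclassP s t : tens_rel s t <-> tclass s = tclass t.
Proof.
split=> [st|/eqP]; last by rewrite /tclass piE => /asboolP.
by apply/eqP; rewrite /tclass piE; apply/asboolP.
Qed.

Lemma tclassK x : tclass (repr x) = x.
Proof. exact: reprK. Qed.

Definition tadd (x y : tensor) : tensor := tclass (repr x ++ repr y).
Definition topp (x : tensor) : tensor :=
  tclass [seq (- p.1, p.2) | p <- repr x].

Lemma tclassD s t : tadd (tclass s) (tclass t) = tclass (s ++ t).
Proof. by apply/tclassP; apply: tr_cat; apply/tclassP; exact: tclassK. Qed.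

Lemma taddA : associative tadd.
Proof.
by move=> x y z; rewrite -(tclassK x) -(tclassK y) -(tclassK z) !tclassD catA.
Qed.

Lemma taddC : commutative tadd.
Proof. by move=> x y; apply/tclassP; exact: tr_catC. Qed.

Lemma tadd0 : left_id (tclass [::]) tadd.
Proof. by move=> x; rewrite -(tclassK x) tclassD. Qed.

Lemma taddN : left_inverse (tclass [::]) topp tadd.
Proof.
move=> x; rewrite -[in RHS](tclassK (tclass [::])) tclassK.
rewrite -{2}(tclassK x) /topp; elim: (repr x) => [|[m n] s IHs] /=.
  by rewrite tclassD.
have e1 p t : tclass (p :: t) = tadd (tclass [:: p]) (tclass t).
  by rewrite tclassD.
have e2 : tadd (tclass [:: (- m, n)]) (tclass [:: (m, n)]) = tclass [::].
  rewrite tclassD; apply/tclassP.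
  apply: (tr_trans _ (tr_zero n)); rewrite -(addNr m).
  exact/tr_sym/tr_addl.
rewrite (e1 (- m, n)) (e1 (m, n)) -taddA (taddC (tclass [:: (m, n)])).
rewrite [tadd (tclass (map _ _)) _]taddA IHs tadd0.
exact: e2.
Qed.

HB.instance Definition _ :=
  GRing.isZmodule.Build tensor taddA taddC tadd0 taddN.

Definition tens (m : M) (n : N) : tensor := tclass [:: (m, n)].

Definition balanced (W : zmodType) (f : M -> N -> W) : Prop :=
  [/\ forall m m' n, f (m + m') n = f m n + f m' n,
      forall m n n', f m (n + n') = f m n + f m n'
    & forall m r n, f (ra m r) n = f m (la r n)].

(* The additive map sending m (x) n to f m n; meaningful for f balanced, see
   tlift_tens and tliftD. *)
Definition tlift (W : zmodType) (f : M -> N -> W) (x : tensor) : W :=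
  \sum_(p <- repr x) f p.1 p.2.

Lemma tens_balanced : balanced tens.
Proof.
split=> [m m' n|m n n'|m r n].
- by rewrite [RHS]tclassD; apply/tclassP; exact: tr_addl.
- by rewrite [RHS]tclassD; apply/tclassP; exact: tr_addr.
- by apply/tclassP; exact: tr_bal.
Qed.

Lemma tclass_sum s : tclass s = \sum_(p <- s) tens p.1 p.2.
Proof.
elim: s => [|[m n] s IHs]; first by rewrite big_nil.
by rewrite big_cons -IHs [RHS]tclassD.
Qed.

Lemma tensor_sum x : x = \sum_(p <- repr x) tens p.1 p.2.
Proof. by rewrite -tclass_sum tclassK. Qed.

Section Lift.
Variables (W : zmodType) (f : M -> N -> W).
Hypothesis fbal : balanced f.

Lemma tens_rel_sum s t : tens_rel s t ->
  \sum_(p <- s) f p.1 p.2 = \sum_(p <- t) f p.1 p.2.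
Proof.
have [fDl fDr fB] := fbal.
elim=> {s t} [//|s t _ ->//|s t u _ -> _ ->//|s s' t t' _ e1 _ e2|s t|n|||].
- by rewrite !big_cat /= e1 e2.
- by rewrite !big_cat /= addrC.
- rewrite big_seq1 big_nil /=; apply: (addrI (f 0 n)).
  by rewrite -fDl !addr0.
- by move=> m m' n; rewrite !big_cons !big_nil /= fDl !addr0.
- by move=> m n n'; rewrite !big_cons !big_nil /= fDr !addr0.
- by move=> m r n; rewrite !big_seq1 /= fB.
Qed.

Lemma tlift_class s : tlift f (tclass s) = \sum_(p <- s) f p.1 p.2.
Proof. by apply: tens_rel_sum; apply/tclassP; exact: tclassK. Qed.

Lemma tlift_tens m n : tlift f (tens m n) = f m n.
Proof. by rewrite tlift_class big_seq1. Qed.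

Lemma tliftD x y : tlift f (x + y) = tlift f x + tlift f y.
Proof. by rewrite tlift_class big_cat. Qed.

End Lift.
End Tensor.

Definition tensor_over (k : comPzRingType) (V W : lmodType k) : zmodType :=
  tensor (fun (v : V) (c : k) => c *: v) (fun (c : k) (w : W) => c *: w).

Definition tensk (k : comPzRingType) (V W : lmodType k) (v : V) (w : W) :
    tensor_over V W :=
  tens (fun (v : V) (c : k) => c *: v) (fun (c : k) (w : W) => c *: w) v w.

(* As k is commutative, its right modules are taken to be lmodTypes as well. *)
Notation "V ⊗ W" := (tensor_over V W)
  (at level 40, left associativity) : type_scope.

(* Proper two-sided ideals: Idealr provides the additive and left-multiplicative
   closure. *)
HB.mixin Record isRightStable (R : nzRingType) (S : R -> bool) := {
  ideal2Ml_subproof : forall u a, u \in S -> u * a \in S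
}.

#[short(type="ideal2")]
HB.structure Definition Ideal2 (R : nzRingType) :=
  {S of Idealr R S & isRightStable R S}.

Section AlgQuotient.
Variables (k : pzRingType) (A : algType k) (I : ideal2 A).

Definition alg_quot := Quotient.quot (I : zmodClosed A).

HB.instance Definition _ := GRing.Zmodule.on alg_quot.

Definition aproj (a : A) : alg_quot := \pi a.

Lemma aprojP a b : aproj a = aproj b <-> a - b \in I.
Proof.
rewrite /aproj (Quotient.idealrBE (I : zmodClosed A)).
by split=> [->|/eqP].
Qed.

Lemma aprojK x : aproj (repr x) = x.
Proof. exact: reprK. Qed.

Lemma aprojB a b : aproj (a - b) = aproj a - aproj b.
Proof. by rewrite /aproj !piE. Qed.

Lemma aprojD a b : aproj (a + b) = aproj a + aproj b.
Proof. by rewrite /aproj !piE. Qed.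

Definition aone : alg_quot := aproj 1.
Definition amul (x y : alg_quot) : alg_quot := aproj (repr x * repr y).
Definition ascale (c : k) (x : alg_quot) : alg_quot := aproj (c *: repr x).

Lemma aprojM a b : amul (aproj a) (aproj b) = aproj (a * b).
Proof.
apply/aprojP; set a' := repr _; set b' := repr _.
have -> : a' * b' - a * b = (a' - a) * b' + a * (b' - b).
  by rewrite mulrBl mulrBr addrA subrK.
apply: rpredD; first by apply: ideal2Ml_subproof; apply/aprojP/aprojK.
by apply: idealMr; apply/aprojP/aprojK.
Qed.

Lemma aprojZ c a : ascale c (aproj a) = aproj (c *: a).
Proof.
apply/aprojP; rewrite -scalerBr -mulr_algl.
by apply: idealMr; apply/aprojP/aprojK.
Qed.

Lemma amulA : associative amul.
Proof.
by move=> x y z; rewrite -(aprojK x) -(aprojK y) -(aprojK z) !aprojM mulrA.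
Qed.
Lemma amul1 : left_id aone amul.
Proof. by move=> x; rewrite -(aprojK x) aprojM mul1r. Qed.
Lemma amulr1 : right_id aone amul.
Proof. by move=> x; rewrite -(aprojK x) aprojM mulr1. Qed.
Lemma amulDl : left_distributive amul +%R.
Proof.
move=> x y z; rewrite -(aprojK x) -(aprojK y) -(aprojK z).
by rewrite -[aproj _ + aproj (repr y)]aprojD !aprojM -aprojD mulrDl.
Qed.
Lemma amulDr : right_distributive amul +%R.
Proof.
move=> x y z; rewrite -(aprojK x) -(aprojK y) -(aprojK z).
by rewrite -[aproj (repr y) + _]aprojD !aprojM -aprojD mulrDr.
Qed.
Lemma aone_neq0 : aone != 0.
Proof.
apply/eqP => e; have : aproj 1 = aproj 0 by rewrite -(subrr 0) aprojB subrr.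
by move/aprojP; rewrite subr0 idealr1.
Qed.

HB.instance Definition _ := GRing.Zmodule_isNzRing.Build alg_quot
  amulA amul1 amulr1 amulDl amulDr aone_neq0.

Lemma ascaleA a b x : ascale a (ascale b x) = ascale (a * b) x.
Proof. by rewrite -(aprojK x) !aprojZ scalerA. Qed.
Lemma ascale1 : left_id 1 ascale.
Proof. by move=> x; rewrite -(aprojK x) aprojZ scale1r. Qed.
Lemma ascaleDr : right_distributive ascale +%R.
Proof.
move=> a x y; rewrite -(aprojK x) -(aprojK y) -aprojD !aprojZ.
by rewrite -aprojD scalerDr.
Qed.
Lemma ascaleDl x : {morph ascale^~ x : a b / a + b}.
Proof. by move=> a b; rewrite -(aprojK x) !aprojZ -aprojD scalerDl. Qed.

HB.instance Definition _ := GRing.Zmodule_isLmodule.Build k alg_quot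
  ascaleA ascale1 ascaleDr ascaleDl.

Lemma ascaleAl (a : k) (x y : alg_quot) : a *: (x * y) = (a *: x) * y.
Proof.
change (ascale a (amul x y) = amul (ascale a x) y).
by rewrite -(aprojK x) -(aprojK y) !(aprojZ, aprojM) scalerAl.
Qed.

HB.instance Definition _ :=
  GRing.Lmodule_isLalgebra.Build k alg_quot ascaleAl.

Lemma ascaleAr (a : k) (x y : alg_quot) : a *: (x * y) = x * (a *: y).
Proof.
change (ascale a (amul x y) = amul x (ascale a y)).
by rewrite -(aprojK x) -(aprojK y) !(aprojZ, aprojM) scalerAr.
Qed.

HB.instance Definition _ :=
  GRing.Lalgebra_isAlgebra.Build k alg_quot ascaleAr.

(* The map induced on the quotient by an i that preserves I. *)
Definition quot_map (i : A -> A) (x : alg_quot) : alg_quot := aproj (i (repr x)).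

Definition quot_image (S : {pred A}) : {pred alg_quot} :=
  fun x => `[< exists2 a, a \in S & x = aproj a >].

End AlgQuotient.

Definition noetherian (k : comNzRingType) : Prop :=
  forall S : {pred k^o}, GRing.submod_closed S ->
  exists s : seq k, {subset s <= S} /\
    forall x, x \in S ->
      exists c : 'I_(size s) -> k, x = \sum_(j < size s) c j * s`_j.

Definition k_involution (k : pzRingType) (A : algType k) (i : A -> A) : Prop :=
  [/\ linear i, forall x y, i (x * y) = i y * i x & involutive i].

Definition affine_alg (k : pzRingType) (B : comAlgType k) : Prop :=
  exists s : seq B, forall S : {pred B},
    GRing.subalg_closed S -> {subset s <= S} -> forall b, b \in S.

Definition zero_divisor (B : comNzRingType) (x : B) : Prop :=
  exists2 y, y != 0 & x * y = 0.

Definition two_sided_ideal (R : nzRingType) (J : {pred R}) : Prop :=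
  [/\ zmod_closed J, forall a x, x \in J -> a * x \in J
    & forall a x, x \in J -> x * a \in J].

Definition idempotent_ideal (R : nzRingType) (J : {pred R}) : Prop :=
  forall x, x \in J <->
    exists2 s : seq (R * R),
      (forall p, p \in s -> p.1 \in J /\ p.2 \in J)
      & x = \sum_(p <- s) p.1 * p.2.

Definition stable_under (T : Type) (i : T -> T) (J : {pred T}) : Prop :=
  forall x, x \in J <-> exists2 y, y \in J & x = i y.

Definition is_basis (k : pzRingType) (V : lmodType k) (d : nat)
    (v : 'I_d -> V) : Prop :=
  forall x, exists! c : {ffun 'I_d -> k}, x = \sum_r c r *: v r.

Definition left_module (A : nzRingType) (M : zmodType) (act : A -> M -> M)
    : Prop :=
  [/\ forall x, act 1 x = x,
      forall a b x, act (a * b) x = act a (act b x),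
      forall a b x, act (a + b) x = act a x + act b x
    & forall a x y, act a (x + y) = act a x + act a y].

Definition module_hom (A M N : zmodType) (actM : A -> M -> M)
    (actN : A -> N -> N) (f : M -> N) : Prop :=
  (forall x y, f (x + y) = f x + f y) /\
  (forall a x, f (actM a x) = actN a (f x)).

Section CellModule.
Variables (k : comNzRingType) (V : vectType k) (B : comAlgType k).

(* x b on Delta = V ⊗ B, given by (v ⊗ c) b = v ⊗ c b. *)
Definition rightB (x : V ⊗ B) (b : B) : V ⊗ B :=
  tlift (fun v c => tensk v (c * b)) x.

(* b y on Delta' = B ⊗ V, given by b (c ⊗ v) = b c ⊗ v. *)
Definition leftB (b : B) (y : B ⊗ V) : B ⊗ V :=
  tlift (fun c v => tensk (b * c) v) y.

Definition flip (x : V ⊗ B) : B ⊗ V := tlift (fun v b => tensk b v) x.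
Definition flip' (y : B ⊗ V) : V ⊗ B := tlift (fun b v => tensk v b) y.

Definition cell_tensor : zmodType := tensor rightB leftB.

Definition tensB (x : V ⊗ B) (y : B ⊗ V) : cell_tensor :=
  tens rightB leftB x y.

(* u ⊗ b ⊗ v under the identification of Delta ⊗_B Delta' with V ⊗ B ⊗ V. *)
Definition tens3 (u : V) (b : B) (v : V) : cell_tensor :=
  tensB (tensk u b) (tensk 1 v).

Variables (A : algType k) (i : A -> A) (act : A -> V ⊗ B -> V ⊗ B).

(* The last condition says that the two k-module structures on V ⊗ B, through
   A and through B, agree. *)
Definition cell_bimodule : Prop :=
  [/\ left_module act,
      forall a x b, act a (rightB x b) = rightB (act a x) b
    & forall (c : k) x, act c%:A x = rightB x c%:A].

Definition right_act (y : B ⊗ V) (a : A) : B ⊗ V := flip (act (i a) (flip' y)).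

Definition tensor_lact (a : A) (t : cell_tensor) : cell_tensor :=
  tlift (fun x y => tensB (act a x) y) t.

Definition tensor_ract (t : cell_tensor) (a : A) : cell_tensor :=
  tlift (fun x y => tensB x (right_act y a)) t.

End CellModule.

(* A free k-module of finite rank is a vectType over k, of rank dim V. The map
   alpha is only relevant on J, where it is a bijection with inverse alphaV. *)
Record affine_cell_ideal (k : comNzRingType) (A : algType k) (i : A -> A)
    (J : {pred A}) := AffineCellIdeal {
  cell_ideal : two_sided_ideal J;
  cell_stable : stable_under i J;
  cell_V : vectType k;
  cell_rank_gt0 : (0 < dim cell_V)%N;
  cell_B : comAlgType k;
  cell_B_affine : affine_alg cell_B;
  cell_sigma : cell_B -> cell_B;
  cell_sigma_inv : k_involution cell_sigma;
  cell_act : A -> cell_V ⊗ cell_B -> cell_V ⊗ cell_B;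
  cell_actP : cell_bimodule cell_act;
  cell_alpha : A -> cell_tensor cell_V cell_B;
  cell_alphaV : cell_tensor cell_V cell_B -> A;
  cell_alphaV_in : forall t, cell_alphaV t \in J;
  cell_alphaK : {in J, cancel cell_alpha cell_alphaV};
  cell_alphaVK : cancel cell_alphaV cell_alpha;
  cell_alphaD :
    {in J &, forall x y, cell_alpha (x + y) = cell_alpha x + cell_alpha y};
  cell_alphaMl : forall a, {in J, forall x,
    cell_alpha (a * x) = tensor_lact cell_act a (cell_alpha x)};
  cell_alphaMr : forall a, {in J, forall x,
    cell_alpha (x * a) = tensor_ract i cell_act (cell_alpha x) a};
  cell_alpha_inv : forall u b v,
    cell_alpha (i (cell_alphaV (tens3 u b v))) = tens3 v (cell_sigma b) u
}.

Arguments cell_act {k A i J} _ _ _.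
Arguments cell_alpha {k A i J} _ _.
Arguments cell_alphaV {k A i J} _ _.

Record cell_datum (k : comNzRingType) (A : algType k) (i : A -> A)
    (J : {pred A}) := CellDatum {
  datum_cell :> affine_cell_ideal i J;
  datum_psi : cell_V datum_cell -> cell_V datum_cell -> cell_B datum_cell;
  datum_psi_linr : forall u, linear (datum_psi u);
  datum_psi_linl : forall u, linear (datum_psi^~ u);
  datum_psiP : forall u b v u' b' v',
    cell_alpha datum_cell (cell_alphaV datum_cell (tens3 u b v) *
                           cell_alphaV datum_cell (tens3 u' b' v')) =
    tens3 u (b * datum_psi v u' * b') v';
  datum_basis : 'I_(dim (cell_V datum_cell)) -> cell_V datum_cell;
  datum_basisP : is_basis datum_basis
}.

Arguments datum_psi {k A i J} _ _ _.
Arguments datum_basis {k A i J} _ _.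

Definition swich_matrix (k : comNzRingType) (A : algType k) (i : A -> A)
    (J : {pred A}) (D : cell_datum i J) :
    'M[cell_B D]_(dim (cell_V D)) :=
  \matrix_(r, s) datum_psi D (datum_basis D r) (datum_basis D s).

(* J_m, the sum of the first m of the summands J'_0, ..., J'_(n-1). *)
Definition partial_sum (A : zmodType) (n : nat) (J' : 'I_n -> {pred A})
    (m : nat) : {pred A} :=
  fun x => `[< exists2 y : 'I_n -> A,
    (forall l, y l \in J' l) & x = \sum_(l < n | (l < m)%N) y l >].

(* The n layers are indexed by j : 'I_n from 0, so that layer j is
   J_(j+1) / J_j in A / J_j. As J_n = A, only J_0, ..., J_(n-1) are recorded as
   ideals (in ac_low); these are proper since the layers are nonzero. *)
Record affine_cellular (k : comNzRingType) (A : algType k) (i : A -> A) :=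
    AffineCellular {
  ac_n : nat;
  ac_summand : 'I_ac_n -> {pred A};
  ac_summand_submod : forall j, GRing.submod_closed (ac_summand j);
  ac_direct : forall x, exists! y : {ffun 'I_ac_n -> A},
    (forall j, y j \in ac_summand j) /\ x = \sum_j y j;
  ac_summand_stable : forall j, stable_under i (ac_summand j);
  ac_low : 'I_ac_n -> ideal2 A;
  ac_lowE : forall j, ac_low j =i partial_sum ac_summand j;
  ac_datum : forall j,
    cell_datum (@quot_map k A (ac_low j) i)
               (@quot_image k A (ac_low j) (partial_sum ac_summand j.+1))
}.

Arguments ac_summand {k A i} _ _.
Arguments ac_low {k A i} _ _.
Arguments ac_datum {k A i} _ _.

Section CellularNotions.
Variables (k : comNzRingType) (A : algType k) (i : A -> A).
Variable C : affine_cellular i.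
Implicit Type j : 'I_(ac_n C).

Definition ac_layer j : {pred alg_quot (ac_low C j)} :=
  @quot_image k A (ac_low C j) (partial_sum (ac_summand C) j.+1).

Definition ac_B j : comAlgType k := cell_B (ac_datum C j).

Definition cell_module j : zmodType := cell_V (ac_datum C j) ⊗ ac_B j.

(* The cell module as an A-module, through A -> A / J_j. *)
Definition cell_module_act j (a : A) (x : cell_module j) : cell_module j :=
  cell_act (ac_datum C j) (aproj (ac_low C j) a) x.

Definition ac_swich j := swich_matrix (ac_datum C j).

Definition cell_hom j1 j2 (f : cell_module j1 -> cell_module j2) : Prop :=
  module_hom (@cell_module_act j1) (@cell_module_act j2) f.

End CellularNotions.

Arguments ac_layer {k A i} C j _.
Arguments ac_B {k A i} C j.
Arguments cell_module {k A i} C j.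
Arguments cell_module_act {k A i} C j a x.
Arguments ac_swich {k A i} C j.
Arguments cell_hom {k A i C j1 j2} f.

(* Main.v *)
Require Import Defs.
From mathcomp Require Import all_boot all_order all_algebra.
From mathcomp Require Import boolp.
Import GRing.Theory.
Local Open Scope ring_scope.

(** Evaluating [alpha (a x) = a (alpha x)] shows that
    [alpha^-1 (u ⊗ b ⊗ v)] acts on the cell module by
    [w ⊗ c |-> u ⊗ b psi(v, w) c]. If [J] is idempotent, then
    [1 = \sum_l b_l psi(v_l, w_l)] in [B]. Hence
    [u ⊗ c = \sum_l alpha^-1 (u ⊗ c b_l ⊗ v_l) (w_l ⊗ 1)], so [J Delta = Delta],
    and every endomorphism [f] of [Delta] is right multiplication by
    [\sum_l b_l psi(v_l, f (w_l ⊗ 1))], which gives (2) because [Delta] is free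
    over [B]. For (1), the higher of the two layers is annihilated by the ideal
    of the lower one. If the source is the lower layer, then
    [f Delta = f (J Delta) = J (f Delta) = 0]; if the target is, then [J] kills
    the image of [f], so [psi] kills its coordinate vectors, which vanish since
    [det psi] is not a zero-divisor. *)

(** * Tensor products: induction on pure tensors and additive maps *)

Section Tensors.
Context {R : Type} {M N : zmodType} {ra : M -> R -> M} {la : R -> N -> N}.

Lemma tensor_ind (P : tensor ra la -> Prop) :
  P 0 -> (forall x y, P x -> P y -> P (x + y)) ->
  (forall m n, P (tens ra la m n)) -> forall x, P x.
Proof. by move=> P0 PD Pt x; rewrite (tensor_sum x); apply: big_ind. Qed.

Lemma tensDl m m' n :
  tens ra la (m + m') n = tens ra la m n + tens ra la m' n.
Proof. by have [] := tens_balanced ra la. Qed.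

Lemma tensDr m n n' :
  tens ra la m (n + n') = tens ra la m n + tens ra la m n'.
Proof. by have [_] := tens_balanced ra la. Qed.

Lemma tens_bal m r n : tens ra la (ra m r) n = tens ra la m (la r n).
Proof. by have [_ _] := tens_balanced ra la. Qed.

End Tensors.

Lemma additive_eq0 (U W : zmodType) (f : U -> W) :
  {morph f : x y / x + y} -> f 0 = 0.
Proof. by move=> fD; apply: (addrI (f 0)); rewrite -fD !addr0. Qed.

Lemma additive_sum (U W : zmodType) (f : U -> W) (I : Type) (s : seq I)
    (F : I -> U) :
  {morph f : x y / x + y} -> f (\sum_(l <- s) F l) = \sum_(l <- s) f (F l).
Proof. by move=> fD; apply: big_morph => //; apply: additive_eq0. Qed.

(** Restated with [tensk], so that induction leaves goals in the form that the lemmas on [tensk]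
    rewrite. *)
Lemma tensor_over_ind (k : comPzRingType) (V W : lmodType k)
    (P : V ⊗ W -> Prop) :
  P 0 -> (forall x y, P x -> P y -> P (x + y)) ->
  (forall v w, P (tensk v w)) -> forall x, P x.
Proof. exact: tensor_ind. Qed.

Section Tensk.
Context {k : comPzRingType} {V W : lmodType k}.

Lemma tenskDl (w : W) : {morph (@tensk k V W)^~ w : v v' / v + v'}.
Proof. by move=> v v'; apply: tensDl. Qed.

Lemma tenskDr (v : V) : {morph @tensk k V W v : w w' / w + w'}.
Proof. by move=> w w'; apply: tensDr. Qed.

Lemma tensk0 (v : V) : tensk v (0 : W) = 0.
Proof. exact: additive_eq0 (tenskDr v). Qed.

Lemma tensk_suml (I : Type) (s : seq I) (F : I -> V) (w : W) :
  tensk (\sum_(l <- s) F l) w = \sum_(l <- s) tensk (F l) w.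
Proof. exact: additive_sum (tenskDl w). Qed.

Lemma tensk_sumr (I : Type) (s : seq I) (v : V) (F : I -> W) :
  tensk v (\sum_(l <- s) F l) = \sum_(l <- s) tensk v (F l).
Proof. exact: additive_sum (tenskDr v). Qed.

End Tensk.

(** * The $B$-module structures on $\Delta$, $\Delta'$ and their tensor product *)

Section BModules.
Context {k : comNzRingType} {V : vectType k} {B : comAlgType k}.
Implicit Types (x : V ⊗ B) (y : B ⊗ V).

Lemma rightB_balanced (b : B) :
  balanced (fun (v : V) (c : k) => c *: v) (fun (c : k) (e : B) => c *: e)
    (fun v c => tensk v (c * b)).
Proof.
split=> [v v' c|v c c'|v r c].
- exact: tensDl.
- by rewrite mulrDl; apply: tensDr.
- by rewrite -scalerAl; apply: tens_bal.
Qed.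

Lemma rightB_tens (v : V) (c b : B) : rightB (tensk v c) b = tensk v (c * b).
Proof. exact: tlift_tens (rightB_balanced b) _ _. Qed.

Lemma rightBDl (b : B) : {morph (@rightB k V B)^~ b : x x' / x + x'}.
Proof. exact: tliftD (rightB_balanced b). Qed.

Lemma rightBDr x (b b' : B) : rightB x (b + b') = rightB x b + rightB x b'.
Proof.
elim/tensor_over_ind: x => [|x x' IHx IHx'|v c].
- by rewrite !(additive_eq0 _ _ _ (rightBDl _)) addr0.
- by rewrite !rightBDl IHx IHx' addrACA.
- by rewrite !rightB_tens mulrDr tenskDr.
Qed.

Lemma rightBA x (b b' : B) : rightB (rightB x b) b' = rightB x (b * b').
Proof.
elim/tensor_over_ind: x => [|x x' IHx IHx'|v c].
- by rewrite !(additive_eq0 _ _ _ (rightBDl _)).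
- by rewrite !rightBDl IHx IHx'.
- by rewrite !rightB_tens mulrA.
Qed.

Lemma leftB_balanced (b : B) :
  balanced (fun (c : B) (r : k) => r *: c) (fun (r : k) (v : V) => r *: v)
    (fun c v => tensk (b * c) v).
Proof.
split=> [c c' v|c v v'|c r v].
- by rewrite mulrDr; apply: tensDl.
- exact: tensDr.
- by rewrite -scalerAr; apply: tens_bal.
Qed.

Lemma leftB_tens (b c : B) (v : V) : leftB b (tensk c v) = tensk (b * c) v.
Proof. exact: tlift_tens (leftB_balanced b) _ _. Qed.

Lemma leftBD (b : B) : {morph @leftB k V B b : y y' / y + y'}.
Proof. exact: tliftD (leftB_balanced b). Qed.

Lemma tensBDl y : {morph (@tensB k V B)^~ y : x x' / x + x'}.
Proof. by move=> x x'; apply: tensDl. Qed.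

Lemma tensBDr x : {morph @tensB k V B x : y y' / y + y'}.
Proof. by move=> y y'; apply: tensDr. Qed.

Lemma cell_tensor_tensB_ind (P : cell_tensor V B -> Prop) :
  P 0 -> (forall s t, P s -> P t -> P (s + t)) ->
  (forall x y, P (tensB x y)) -> forall t, P t.
Proof. exact: tensor_ind. Qed.

(** Since $c \otimes v = c(1 \otimes v)$, balancing over $B$ moves every scalar of the right factor
    into the left one. *)
Lemma cell_tensor_ind (P : cell_tensor V B -> Prop) :
  P 0 -> (forall s t, P s -> P t -> P (s + t)) ->
  (forall u b v, P (tens3 u b v)) -> forall t, P t.
Proof.
move=> P0 PD Pt; elim/cell_tensor_tensB_ind => // x y.
elim/tensor_over_ind: x => [|x x' IHx IHx'|u b].
- by rewrite (additive_eq0 _ _ _ (tensBDl y)).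
- by rewrite tensBDl; apply: PD.
elim/tensor_over_ind: y => [|y y' IHy IHy'|c v].
- by rewrite (additive_eq0 _ _ _ (tensBDr _)).
- by rewrite tensBDr; apply: PD.
have <- : tens3 u (b * c) v = tensB (tensk u b) (tensk c v).
  rewrite /tens3 -rightB_tens -[c in RHS]mulr1 -leftB_tens.
  exact: tens_bal.
exact: Pt.
Qed.


(** * Contraction along a linear functional on $V$ *)

Section Functional.
Variables (phi : V -> k) (phi_lin : scalar phi).

Let phiD v v' : phi (v + v') = phi v + phi v'.
Proof. by have := phi_lin 1 v v'; rewrite /= !scale1r mul1r. Qed.

Let phi0 : phi 0 = 0. Proof. exact: additive_eq0 phiD. Qed.

Let phiZ c v : phi (c *: v) = c * phi v.
Proof. by have := phi_lin c v 0; rewrite /= phi0 !addr0. Qed.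

(** The map $\phi \otimes \mathrm{id}$ into $k \otimes_k B = B$; [evall] is its mirror image on
    $\Delta'$. *)
Definition evalr (x : V ⊗ B) : B := tlift (fun v b => phi v *: b) x.

Definition evall (y : B ⊗ V) : B := tlift (fun b v => phi v *: b) y.

Lemma evalr_balanced :
  balanced (fun (v : V) (c : k) => c *: v) (fun (c : k) (b : B) => c *: b)
    (fun v b => phi v *: b).
Proof.
split=> [v v' b|v b b'|v r b]; last by rewrite phiZ scalerA mulrC.
- by rewrite phiD scalerDl.
- by rewrite scalerDr.
Qed.

Lemma evall_balanced :
  balanced (fun (b : B) (c : k) => c *: b) (fun (c : k) (v : V) => c *: v)
    (fun b v => phi v *: b).
Proof.
split=> [b b' v|b v v'|b r v]; last by rewrite phiZ scalerA mulrC.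
- by rewrite scalerDr.
- by rewrite phiD scalerDl.
Qed.

Lemma evalr_tens v b : evalr (tensk v b) = phi v *: b.
Proof. exact: tlift_tens evalr_balanced _ _. Qed.

Lemma evalrD : {morph evalr : x x' / x + x'}.
Proof. exact: tliftD evalr_balanced. Qed.

Lemma evall_tens b v : evall (tensk b v) = phi v *: b.
Proof. exact: tlift_tens evall_balanced _ _. Qed.

Lemma evallD : {morph evall : y y' / y + y'}.
Proof. exact: tliftD evall_balanced. Qed.

Lemma evalr_rightB x (b : B) : evalr (rightB x b) = evalr x * b.
Proof.
elim/tensor_over_ind: x => [|x x' IHx IHx'|v c].
- by rewrite (additive_eq0 _ _ _ (rightBDl _)) (additive_eq0 _ _ _ evalrD) mul0r.
- by rewrite rightBDl !evalrD IHx IHx' mulrDl.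
- by rewrite rightB_tens !evalr_tens scalerAl.
Qed.

Lemma evall_leftB (b : B) y : evall (leftB b y) = b * evall y.
Proof.
elim/tensor_over_ind: y => [|y y' IHy IHy'|c v].
- by rewrite (additive_eq0 _ _ _ (leftBD _)) (additive_eq0 _ _ _ evallD) mulr0.
- by rewrite leftBD !evallD IHy IHy' mulrDr.
- by rewrite leftB_tens !evall_tens scalerAr.
Qed.

(** The map from $\Delta \otimes_B \Delta'$ to $\Delta \otimes_B B = \Delta$ that applies $\phi$ to
    the last factor $V$. *)
Definition contract (t : cell_tensor V B) : V ⊗ B :=
  tlift (fun x y => rightB x (evall y)) t.

Lemma contract_balanced :
  balanced (@rightB k V B) (@leftB k V B) (fun x y => rightB x (evall y)).
Proof.
split=> [x x' y|x y y'|x b y].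
- exact: rightBDl.
- by rewrite evallD rightBDr.
- by rewrite evall_leftB rightBA.
Qed.

Lemma contract_tens x y : contract (tensB x y) = rightB x (evall y).
Proof. exact: tlift_tens contract_balanced _ _. Qed.

Lemma contractD : {morph contract : s t / s + t}.
Proof. exact: tliftD contract_balanced. Qed.

Lemma contract_tens3 u b v : contract (tens3 u b v) = tensk u (phi v *: b).
Proof.
by rewrite contract_tens evall_tens rightB_tens -scalerAr mulr1.
Qed.

End Functional.
End BModules.

(** * Coordinates on the cell module and the action of the ideal *)

Section CellIdeal.
Context {k : comNzRingType} {A : algType k} {i : A -> A} {J : {pred A}}.
Variable D : cell_datum i J.
Local Notation V := (cell_V D).
Local Notation B := (cell_B D).
Local Notation act := (cell_act D).
Local Notation alpha := (cell_alpha D).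
Local Notation alphaV := (cell_alphaV D).
Local Notation psi := (datum_psi D).
Local Notation bas := (datum_basis D).

Definition coords (v : V) : {ffun 'I_(dim V) -> k} :=
  projT1 (cid (@datum_basisP _ _ _ _ D v)).

Lemma coordsE v : v = \sum_r coords v r *: bas r.
Proof. by rewrite /coords; case: cid => c []. Qed.

Lemma coords_uniq v (c : {ffun 'I_(dim V) -> k}) :
  v = \sum_r c r *: bas r -> coords v = c.
Proof. by rewrite /coords; case: cid => c' [_] /= + vE; apply. Qed.

(** Linearity comes from uniqueness: the combined coordinates represent the combined vector. *)
Lemma coords_scalar r : scalar (coords^~ r).
Proof.
move=> c v v'; rewrite (coords_uniq _ [ffun s => c * coords v s + coords v' s]).
  by rewrite ffunE.
rewrite {1}(coordsE v) {1}(coordsE v') scaler_sumr -big_split /=.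
by apply: eq_bigr => s _; rewrite ffunE scalerDl scalerA.
Qed.

Lemma coords_basis r : coords (bas r) r = 1.
Proof.
rewrite (coords_uniq _ [ffun s => (s == r)%:R]) ?ffunE ?eqxx //.
rewrite (bigD1 r) //= ffunE eqxx scale1r big1 ?addr0 // => s /negbTE sr.
by rewrite ffunE sr scale0r.
Qed.

(** This is the freeness of $\Delta$ over $B$ on the elements [bas r] $\otimes 1$, with [evalr] as
    coordinate functions. *)
Lemma cell_coordE (x : V ⊗ B) :
  x = \sum_r tensk (bas r) (evalr (coords^~ r) x).
Proof.
elim/tensor_over_ind: x => [|x x' IHx IHx'|v c].
- rewrite big1 // => r _.
  rewrite (additive_eq0 _ _ _ (evalrD _ (coords_scalar r))).
  exact: tensk0.
- rewrite {1}IHx {1}IHx' -big_split /=; apply: eq_bigr => r _.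
  by rewrite (evalrD _ (coords_scalar r)); rewrite tenskDr.
- rewrite {1}(coordsE v) tensk_suml; apply: eq_bigr => r _.
  by rewrite (evalr_tens _ (coords_scalar r)); apply: tens_bal.
Qed.

Definition r0 : 'I_(dim V) := Ordinal (cell_rank_gt0 D).

Lemma actDr a : {morph act a : x y / x + y}.
Proof. by have [[_ _ _ +] _ _] := cell_actP D; apply. Qed.

Lemma actDl x : {morph act^~ x : a b / a + b}.
Proof. by have [[_ _ + _] _ _] := cell_actP D => + a b; apply. Qed.

Lemma act_rightB a x b : act a (rightB x b) = rightB (act a x) b.
Proof. by have [_ + _] := cell_actP D; apply. Qed.

Lemma tensor_lact_balanced a :
  balanced (@rightB k V B) (@leftB k V B) (fun x y => tensB (act a x) y).
Proof.
split=> [x x' y|x y y'|x b y].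
- by rewrite actDr; apply: tensDl.
- exact: tensDr.
- by rewrite act_rightB; apply: tens_bal.
Qed.

Lemma tensor_lact_tens a x y :
  tensor_lact act a (tensB x y) = tensB (act a x) y.
Proof. exact: tlift_tens (tensor_lact_balanced a) _ _. Qed.

Lemma tensor_lactD a : {morph tensor_lact act a : s t / s + t}.
Proof. exact: tliftD (tensor_lact_balanced a). Qed.

(** The value of [alpha] on a product is known both from [psi] and from left linearity; comparing
    the two and contracting the last factor isolates the action on $\Delta$. *)
Lemma act_alphaV_tens u b v w c :
  act (alphaV (tens3 u b v)) (tensk w c) = tensk u (b * psi v w * c).
Proof.
(* The last factor is [bas r0] because the functional [coords^~ r0] sends it to 1; such an index
   exists as the rank is positive. *)
have := datum_psiP u b v w c (bas r0).
rewrite cell_alphaMl ?cell_alphaV_in // cell_alphaVK tensor_lact_tens.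
have phi_lin := coords_scalar r0.
move/(congr1 (contract (coords^~ r0))).
rewrite contract_tens // contract_tens3 // evall_tens // coords_basis !scale1r.
by rewrite -act_rightB rightB_tens mulr1.
Qed.

(** The $B$-linear extension of $\psi(v, -)$ from $V$ to $\Delta$. *)
Definition psiB (v : V) (x : V ⊗ B) : B := tlift (fun w c => psi v w * c) x.

Lemma psiB_balanced v :
  balanced (fun (w : V) (c : k) => c *: w) (fun (c : k) (b : B) => c *: b)
    (fun w c => psi v w * c).
Proof.
have psiD w w' : psi v (w + w') = psi v w + psi v w'.
  by have := datum_psi_linr v 1 w w'; rewrite !scale1r.
have psiZ c w : psi v (c *: w) = c *: psi v w.
  have := datum_psi_linr v c w 0.
  by rewrite (additive_eq0 _ _ _ psiD) !addr0.
split=> [w w' c|w c c'|w r c].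
- by rewrite psiD mulrDl.
- by rewrite mulrDr.
- by rewrite psiZ -scalerAl scalerAr.
Qed.

Lemma psiB_tens v w c : psiB v (tensk w c) = psi v w * c.
Proof. exact: tlift_tens (psiB_balanced v) _ _. Qed.

Lemma psiBD v : {morph psiB v : x y / x + y}.
Proof. exact: tliftD (psiB_balanced v). Qed.

Lemma act_alphaV u b v x :
  act (alphaV (tens3 u b v)) x = tensk u (b * psiB v x).
Proof.
elim/tensor_over_ind: x => [|x x' IHx IHx'|w c].
- rewrite (additive_eq0 _ _ _ (actDr _)) (additive_eq0 _ _ _ (psiBD _)) mulr0.
  by rewrite tensk0.
- by rewrite actDr psiBD mulrDr tenskDr IHx IHx'.
- by rewrite act_alphaV_tens psiB_tens mulrA.
Qed.

Lemma idealD : {in J &, forall a b, a + b \in J}.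
Proof.
have [[J0 JB] _ _] := cell_ideal D => a b Ja Jb.
by rewrite -[b]opprK JB // -sub0r JB.
Qed.

Lemma alphaVD : {morph alphaV : s t / s + t}.
Proof.
move=> s t; rewrite -[RHS](cell_alphaK D).
  by rewrite cell_alphaD ?cell_alphaV_in // !cell_alphaVK.
by rewrite idealD ?cell_alphaV_in.
Qed.

(** * The ideal of $B$ generated by the values of $\psi$ *)

Definition psi_span (b : B) : Prop :=
  exists s : seq (B * V * V), b = \sum_(p <- s) p.1.1 * psi p.1.2 p.2.

Lemma psi_spanD b b' : psi_span b -> psi_span b' -> psi_span (b + b').
Proof. by move=> [s ->] [s' ->]; exists (s ++ s'); rewrite big_cat. Qed.

Lemma psi_span0 : psi_span 0.
Proof. by exists [::]; rewrite big_nil. Qed.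

Lemma psi_spanM c b : psi_span b -> psi_span (c * b).
Proof.
move=> [s ->]; exists [seq (c * p.1.1, p.1.2, p.2) | p <- s].
by rewrite big_map mulr_sumr; apply: eq_bigr => p _; rewrite mulrA.
Qed.

Lemma psiB_span v x : psi_span (psiB v x).
Proof.
elim/tensor_over_ind: x => [|x x' IHx IHx'|w c].
- by rewrite (additive_eq0 _ _ _ (psiBD _)); apply: psi_span0.
- by rewrite psiBD; apply: psi_spanD.
- by rewrite psiB_tens mulrC; exists [:: (c, v, w)]; rewrite big_seq1.
Qed.

Lemma evalr_act_span r a x : a \in J -> psi_span (evalr (coords^~ r) (act a x)).
Proof.
have phi_lin := coords_scalar r.
move=> Ja; rewrite -(cell_alphaK D Ja).
elim/(@cell_tensor_ind k V B): (alpha a) => [|s t IHs IHt|u b v].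
- rewrite (additive_eq0 _ _ _ alphaVD) (additive_eq0 _ _ _ (actDl x)).
  by rewrite (additive_eq0 _ _ _ (evalrD _ phi_lin)); apply: psi_span0.
- by rewrite alphaVD actDl evalrD //; apply: psi_spanD.
- rewrite act_alphaV evalr_tens // scalerAl.
  exact/psi_spanM/psiB_span.
Qed.

(** By left linearity [alpha (a * b)] is a sum of tensors with left factor in $J\Delta$, whose
    coordinates lie in the span; the right factors only contribute multipliers from $B$. *)
Lemma alpha_mul_span r a b : a \in J -> b \in J ->
  psi_span (evalr (coords^~ r) (contract (coords^~ r) (alpha (a * b)))).
Proof.
have phi_lin := coords_scalar r.
move=> Ja Jb; rewrite cell_alphaMl //.
elim/(@cell_tensor_tensB_ind k V B): (alpha b) => [|s t IHs IHt|x y].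
- rewrite (additive_eq0 _ _ _ (tensor_lactD a)).
  rewrite (additive_eq0 _ _ _ (contractD _ phi_lin)).
  by rewrite (additive_eq0 _ _ _ (evalrD _ phi_lin)); apply: psi_span0.
- by rewrite tensor_lactD contractD // evalrD //; apply: psi_spanD.
- rewrite tensor_lact_tens contract_tens // evalr_rightB // mulrC.
  exact/psi_spanM/evalr_act_span.
Qed.

(** The element of $J$ with matrix $E_{r_0 r_0}$ is a sum of products from $J$, so its entry 1 at
    that place lies in the span. *)
Lemma idempotent_psi_span1 : idempotent_ideal J -> psi_span 1.
Proof.
have phi_lin := coords_scalar r0.
move=> /(_ (alphaV (tens3 (bas r0) 1 (bas r0)))) [+ _].
move=> /(_ (cell_alphaV_in _)) [s sJ sE].
have Jmul a b : a \in J -> b \in J -> a * b \in J.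
  by have [_ Jl _] := cell_ideal D => _; apply: Jl.
have J0 : 0 \in J by have [[]] := cell_ideal D.
(* Membership in $J$ is carried through the induction because [alpha] is additive only on $J$. *)
have : psi_span (evalr (coords^~ r0) (contract (coords^~ r0)
    (alpha (\sum_(p <- s) p.1 * p.2)))) /\ \sum_(p <- s) p.1 * p.2 \in J.
  elim: {sE}s sJ => [|p s IHs] sJ.
    rewrite big_nil; split=> //.
    (* The empty sum is read as the product [0 * 0]. *)
    by have := alpha_mul_span r0 _ _ J0 J0; rewrite mulr0.
  have [p1 p2] := sJ p (mem_head _ _).
  have [|IH Js] := IHs; first by move=> q qs; apply: sJ; rewrite inE qs orbT.
  have Jp := Jmul _ _ p1 p2.
  rewrite big_cons; split; last exact: idealD.
  rewrite cell_alphaD // contractD // evalrD //.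
  by apply: psi_spanD => //; apply: alpha_mul_span.
case; rewrite -sE cell_alphaVK contract_tens3 // coords_basis scale1r.
by rewrite evalr_tens // coords_basis scale1r.
Qed.

(** * Consequences of idempotence and of a regular determinant *)

Lemma idempotent_generation : idempotent_ideal J ->
  exists s : seq (B * V * V), forall u c,
    tensk u c = \sum_(p <- s)
      act (alphaV (tens3 u (c * p.1.1) p.1.2)) (tensk p.2 1).
Proof.
move=> /idempotent_psi_span1[s s1]; exists s => u c.
rewrite -{1}[c]mulr1 {1}s1 mulr_sumr tensk_sumr; apply: eq_bigr => p _.
by rewrite act_alphaV_tens mulr1 mulrA.
Qed.

Lemma idempotent_hom_eq0 (W : zmodType) (f : V ⊗ B -> W) :
  idempotent_ideal J -> {morph f : x y / x + y} ->
  (forall a x, a \in J -> f (act a x) = 0) -> forall x, f x = 0.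
Proof.
move=> /idempotent_generation[s sE] fD fJ; elim/tensor_over_ind => [|x y fx fy|u c].
- exact: additive_eq0.
- by rewrite fD fx fy addr0.
rewrite sE additive_sum // big1 // => p _.
by rewrite fJ ?cell_alphaV_in.
Qed.

(** Applying [f] to the expansion of $u \otimes c$ gives $u \otimes c b$, where $b$ depends only on
    the images of the finitely many generators $w_l \otimes 1$. *)
Lemma idempotent_endo (f : V ⊗ B -> V ⊗ B) :
  idempotent_ideal J -> {morph f : x y / x + y} ->
  (forall a x, f (act a x) = act a (f x)) ->
  exists b, forall x, f x = rightB x b.
Proof.
move=> /idempotent_generation[s sE] fD fJ.
exists (\sum_(p <- s) p.1.1 * psiB p.1.2 (f (tensk p.2 1))).
elim/tensor_over_ind => [|x y fx fy|u c].
- by rewrite additive_eq0 // (additive_eq0 _ _ _ (rightBDl _)).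
- by rewrite fD fx fy rightBDl.
rewrite rightB_tens mulr_sumr tensk_sumr sE additive_sum //.
by apply: eq_bigr => p _; rewrite fJ act_alphaV mulrA.
Qed.

(** Right multiplication by $b$ multiplies each coordinate by $b$, which cancels in a domain. *)
Lemma rightB_inj b : GRing.integral_domain_axiom B -> b != 0 ->
  injective ((@rightB k V B)^~ b).
Proof.
move=> Bdom b0 x y xy; rewrite [x]cell_coordE [y]cell_coordE.
apply: eq_bigr => r _; congr (tensk _ _).
have := congr1 (evalr (coords^~ r)) xy.
rewrite !(evalr_rightB _ (coords_scalar r)) => /eqP.
rewrite -subr_eq0 -mulrBl => /eqP /Bdom.
by rewrite (negbTE b0) orbF subr_eq0 => /eqP.
Qed.

Lemma annihilated_eq0 x : ~ zero_divisor (\det (swich_matrix D)) ->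
  (forall a, a \in J -> act a x = 0) -> x = 0.
Proof.
move=> det_reg Jx; set e := \col_r evalr (coords^~ r) x.
have psi_e : swich_matrix D *m e = 0.
  apply/matrixP => r c; rewrite !mxE.
  (* The element with matrix $E_{r_0 r}$ sends $x$ to [bas r0] $\otimes$ [psiB (bas r) x], whose
     only coefficient is row $r$ of $\psi e$. *)
  have /(congr1 (evalr (coords^~ r0))) :=
    Jx _ (cell_alphaV_in (a0 := D) (tens3 (bas r0) 1 (bas r))).
  have phi_lin := coords_scalar r0.
  rewrite act_alphaV evalr_tens // (additive_eq0 _ _ _ (evalrD _ phi_lin)).
  rewrite coords_basis scale1r mul1r [in psiB _ x](cell_coordE x).
  rewrite (additive_sum _ _ _ _ _ _ (psiBD _)); apply: etrans.
  by apply: eq_bigr => s _; rewrite !mxE psiB_tens.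
have det_e : \det (swich_matrix D) *: e = 0.
  (* Multiplying $\psi e = 0$ by the adjugate replaces $\psi$ by its determinant. *)
  by rewrite -mul_scalar_mx -mul_adj_mx -mulmxA psi_e mulmx0.
rewrite [x]cell_coordE big1 // => r _.
have -> : evalr (coords^~ r) x = 0.
  have [//|ne0] := eqVneq (evalr (coords^~ r) x) 0.
  case: det_reg; exists (evalr (coords^~ r) x) => //.
  by have /matrixP/(_ r 0) := det_e; rewrite !mxE.
exact: tensk0.
Qed.

End CellIdeal.

(** * Lower layers annihilate higher cell modules *)

Section CellChain.
Context {k : comNzRingType} {A : algType k} {i : A -> A}.
Variable C : affine_cellular i.
Implicit Type j : 'I_(ac_n C).

Lemma ac_lowS j1 j2 a : (j1 < j2)%N ->
  a \in partial_sum (ac_summand C) j1.+1 -> a \in ac_low C j2.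
Proof.
move=> j12; rewrite ac_lowE => /asboolP[y Jy ->]; apply/asboolP.
(* The terms beyond index [j1] are set to 0, since the sum for [ac_low C j2] runs over all indices
   below [j2]. *)
exists (fun l : 'I_(ac_n C) => if (l < j1.+1)%N then y l else 0) => [l|].
  by case: ifP => // _; have [] := ac_summand_submod l.
rewrite [RHS]big_mkcond [LHS]big_mkcond; apply: eq_bigr => l _.
case: ifP => lj; last by case: ifP.
by rewrite (leq_trans lj j12).
Qed.

Lemma cell_module_act_low j a x : a \in ac_low C j ->
  cell_module_act C j a x = 0.
Proof.
move=> ja; rewrite /cell_module_act.
have -> : aproj (ac_low C j) a = 0.
  by rewrite -(subrr (aproj _ 0)) -aprojB subr0; apply/aprojP; rewrite subr0.
exact: additive_eq0 (actDl (ac_datum C j) x).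
Qed.

(** A lift of [b] taken from the first [j1 + 1] summands lies in [ac_low C j2], through which $A$
    acts on the higher cell module. *)
Lemma cell_module_act_lt j1 j2 b : (j1 < j2)%N -> b \in ac_layer C j1 ->
  exists2 a, b = aproj (ac_low C j1) a & forall y, cell_module_act C j2 a y = 0.
Proof.
move=> j12 /asboolP[a Ja ->]; exists a => // y.
exact/cell_module_act_low/(ac_lowS j1).
Qed.

End CellChain.

(** * Homomorphisms between cell modules *)

Theorem corollary6 (k : idomainType) (k_noeth : noetherian k)
    (A : algType k) (i : A -> A) (i_inv : k_involution i)
    (C : affine_cellular i) :
  ((forall j : 'I_(ac_n C),
      idempotent_ideal (ac_layer C j) /\
      ~ zero_divisor (\det (ac_swich C j))) ->
   forall (j1 j2 : 'I_(ac_n C)), j1 <> j2 ->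
   forall f : cell_module C j1 -> cell_module C j2,
     cell_hom f -> forall x, f x = 0)
  /\
  (forall j : 'I_(ac_n C),
     idempotent_ideal (ac_layer C j) ->
     GRing.integral_domain_axiom (ac_B C j) ->
     forall f : cell_module C j -> cell_module C j,
       cell_hom f -> (exists x, f x <> 0) -> injective f).
Proof.
split=> [hyp j1 j2 j12 f [fD fact]|j idem Bdom f [fD fact] [x0 fx0]].
  have [lt12|lt21|/val_inj//] := ltngtP j1 j2.
    (* Source in the lower layer: lifts of its ideal annihilate the target. *)
    have [idem _] := hyp j1.
    apply: (idempotent_hom_eq0 (ac_datum C j1)) => // b x.
    case/(cell_module_act_lt C j1 j2 b lt12) => a -> a0.
    by rewrite -[cell_act _ _ _]/(cell_module_act C j1 a x) fact a0.
  (* Target in the lower layer: lifts of its ideal annihilate the source, hence also [f x]. *)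
  move=> x; have [_ det_reg] := hyp j2.
  apply: (annihilated_eq0 (ac_datum C j2)) => // b.
  case/(cell_module_act_lt C j2 j1 b lt21) => a -> a0.
  rewrite -[cell_act _ _ _]/(cell_module_act C j2 a (f x)) -fact a0.
  exact: additive_eq0.
have [|b fE] := idempotent_endo (ac_datum C j) f idem fD.
  (* Every element of the quotient algebra lifts to $A$, so $A$-linearity of [f] is linearity over
     the quotient. *)
  by move=> a x; rewrite -(aprojK a); apply: fact.
have b0 : b != 0.
  apply/eqP => b0; apply: fx0; rewrite fE b0.
  by apply: (additive_eq0 _ _ (rightB x0)) => ? ?; apply: rightBDr.
by move=> x y; rewrite !fE; apply: rightB_inj.
Qed.
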